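(* Let $1\le p<2$. There are constants $c_0,c_1,c_2>0$ such that for all $n,N\in\mathbb{N}$ with $c_0\sqrt{N}\le n\le c_1N$, $$ e_n^q(S_N,\mathcal{B}_p^N)\ge c_2\, n^{-2/p}N^{2/p-1}. $$
   Context: Throughout, $\log=\log_2$, $\mathbb{N}=\{1,2,\dots\}$, $\mathbb{N}_0=\mathbb{N}\cup\{0\}$, and $\mathbb{Z}[0,N)=\{0,\dots,N-1\}$. Quantum model. Let $D,K$ be nonempty sets, $F$ a nonempty set of functions $D\to K$, $G$ a normed space over $\mathbb{R}$ or $\mathbb{C}$, and $S:F\to G$. Let $H_m=(\mathbb{C}^2)^{\otimes m}$ with canonical basis $|i\rangle$, $i\in\mathbb{Z}[0,2^m)$ (via binary expansion). A quantum query is a tuple $Q=(m,m',m'',Z,\tau,\beta)$ with $m,m',m''\in\mathbb{N}$, $m'+m''\le m$, $\emptyset\ne Z\subseteq\mathbb{Z}[0,2^{m'})$, $\tau:Z\to D$, $\beta:K\to\mathbb{Z}[0,2^{m''})$. For $f\in F$ the unitary $Q_f$ on $H_m=H_{m'}\otimes H_{m''}\otimes H_{m-m'-m''}$ is given on basis states by $Q_f|i\rangle|x\rangle|y\rangle=|i\rangle|x\oplus\beta(f(\tau(i)))\rangle|y\rangle$ if $i\in Z$ and $Q_f|i\rangle|x\rangle|y\rangle=|i\rangle|x\rangle|y\rangle$ otherwise, where $\oplus$ is addition mod $2^{m''}$. A quantum algorithm with no measurement is $(Q,(U_j)_{j=0}^n)$ with $n\in\mathbb{N}_0$ and unitaries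 $U_j$ on $H_{m}$, $m=m(Q)$; it defines $A_f=U_nQ_fU_{n-1}\cdots U_1Q_fU_0$ and uses $n$ queries; $A_f(x,y)$ denotes its matrix entries in the canonical basis. A quantum algorithm from $F$ to $G$ with $k\in\mathbb{N}$ measurements is $A=((A_\ell)_{\ell=0}^{k-1},(b_\ell)_{\ell=0}^{k-1},\varphi)$, where each $A_\ell$ is an algorithm with no measurement on $m_\ell$ qubits, $b_0\in\mathbb{Z}[0,2^{m_0})$, $b_\ell:\prod_{i<\ell}\mathbb{Z}[0,2^{m_i})\to\mathbb{Z}[0,2^{m_\ell})$ for $1\le\ell\le k-1$, and $\varphi:\prod_{\ell<k}\mathbb{Z}[0,2^{m_\ell})\to G$. Its output on $f$ is the probability measure $A(f)$ on $G$ which is the distribution of $\varphi(x_0,\dots,x_{k-1})$, where $(x_0,\dots,x_{k-1})$ has probability $\prod_{\ell=0}^{k-1}|A_{\ell,f}(x_\ell,b_\ell(x_0,\dots,x_{\ell-1}))|^2$ (with $b_0$ a constant). Its number of queries is $n_q(A)=\sum_\ell n_q(A_\ell)$. For a random variable $\zeta$ with distribution $A(f)$, let $e(S,A,f)=\inf\{\varepsilon:\ \mathbf{P}\{\|S(f)-\zeta\|>\varepsilon\}\le 1/4\}$, $e(S,A,F)=\sup_{f\in F}e(S,A,f)$, and the $n$-th minimal query error is $e_n^q(S,F)=\inf\{e(S,A,F): A \text{ a quantum algorithm from } F \text{ to } G \text{ with } n_q(A)\le n\}$. Summation setting. For $N\in\mathbb{N}$, $D=\mathbb{Z}[0,N)$,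 $K=G=\mathbb{R}$. For $1\le p<\infty$, $L_p^N$ is the space of functions $f:\mathbb{Z}[0,N)\to\mathbb{R}$ with norm $\|f\|_{L_p^N}=\big(\frac1N\sum_{i=0}^{N-1}|f(i)|^p\big)^{1/p}$; $\mathcal{B}_p^N=\{f\in L_p^N:\|f\|_{L_p^N}\le 1\}$; and $S_N f=\frac1N\sum_{i=0}^{N-1}f(i)$. *)

(* Defs.v *)
From HB Require Import structures.
From mathcomp Require Import all_boot all_order all_algebra.
From mathcomp Require Import complex.
From mathcomp Require Import all_classical all_reals.
From mathcomp Require Import ereal exp.

Set Implicit Arguments. Unset Strict Implicit. Unset Printing Implicit Defensive.
Import Order.TTheory GRing.Theory Num.Theory.
Local Open Scope ring_scope.
Local Open Scope classical_set_scope.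

Section QuantumModel.
Variable R : realType.
Local Notation C := (complex R).

Definition adjmx (m : nat) (U : 'M[C]_m) : 'M[C]_m := (map_mx Num.conj U)^T.
Definition unitary_mx (m : nat) (U : 'M[C]_m) : Prop :=
  U *m adjmx U = 1%:M /\ adjmx U *m U = 1%:M.

Definition sqnorm (z : C) : R := (complex.Re z) ^+ 2 + (complex.Im z) ^+ 2.

Record query (D K : Type) := Query {
  qm : nat; qm1 : nat; qm2 : nat;
  qZ : {set 'I_(2 ^ qm1)};
  qtau : {i : 'I_(2 ^ qm1) | i \in qZ} -> D;
  qbeta : K -> 'I_(2 ^ qm2);
  qm1_pos : (0 < qm1)%N;
  qm2_pos : (0 < qm2)%N;
  qm_le : (qm1 + qm2 <= qm)%N;
  qZ_nonempty : qZ != finset.set0 }.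

(* action of Q_f on basis indices of H_m = H_m' (x) H_m'' (x) H_(m-m'-m''),
   |i>|x>|y> being the basis vector with index i*2^(m-m') + x*2^(m-m'-m'') + y *)
Definition qmap (D K : Type) (Q : query D K) (f : D -> K) (a : nat) : nat :=
  let r := (qm Q - qm1 Q)%N in
  let s := (r - qm2 Q)%N in
  let i := (a %/ 2 ^ r)%N in
  let x := ((a %/ 2 ^ s) %% 2 ^ qm2 Q)%N in
  let y := (a %% 2 ^ s)%N in
  match [pick z : {j : 'I_(2 ^ qm1 Q) | j \in qZ Q} | val (val z) == i] with
  | Some z => (i * 2 ^ r + ((x + val (qbeta Q (f (qtau z)))) %% 2 ^ qm2 Q) * 2 ^ s + y)%N
  | None => a
  end.

Definition qmx (D K : Type) (Q : query D K) (f : D -> K) : 'M[C]_(2 ^ qm Q) :=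
  \matrix_(a, b) ((val a == qmap Q f (val b)) %:R).

Record nalg (D K : Type) := NAlg {
  nQ : query D K;
  nn : nat;
  nU : 'I_nn.+1 -> 'M[C]_(2 ^ qm nQ);
  nU_unitary : forall j, unitary_mx (nU j) }.
Arguments nU {D K} n j.

Fixpoint iter_alg (m : nat) (U : nat -> 'M[C]_m) (Qf : 'M[C]_m) (k : nat)
  : 'M[C]_m :=
  match k with
  | 0 => U 0%N
  | k'.+1 => U k *m Qf *m iter_alg U Qf k'
  end.

Definition nalg_mx (D K : Type) (A : nalg D K) (f : D -> K) : 'M[C]_(2 ^ qm (nQ A)) :=
  iter_alg (fun j => nU A (inord j)) (qmx (nQ A) f) (nn A).

(* A quantum algorithm from F to G = R with k measurements.  Outcomes
   x_0,...,x_(l-1) are passed to b_l and phi as lists of naturals. *)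
Record qalg (D K : Type) := QAlg {
  qk : nat;
  qk_pos : (0 < qk)%N;
  qA : 'I_qk -> nalg D K;
  qb : forall l : 'I_qk, seq nat -> 'I_(2 ^ qm (nQ (qA l)));
  qphi : seq nat -> R }.
Arguments qA {D K} q l.
Arguments qb {D K} q l _.

Definition outcomes (D K : Type) (A : qalg D K) : finType :=
  {dffun forall l : 'I_(qk A), 'I_(2 ^ qm (nQ (qA A l)))}.

Definition prefix (D K : Type) (A : qalg D K) (x : outcomes A) (l : nat) : seq nat :=
  map (fun j => val (x j)) (seq.filter (fun j : 'I_(qk A) => (j < l)%N) (enum 'I_(qk A))).

Definition outcome_prob (D K : Type) (A : qalg D K) (f : D -> K) (x : outcomes A) : R :=
  \prod_(l : 'I_(qk A))
     sqnorm (nalg_mx (qA A l) f (x l) (qb A l (prefix x l))).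

Definition outcome_val (D K : Type) (A : qalg D K) (x : outcomes A) : R :=
  qphi A (prefix x (qk A)).

Definition prob_err (D K : Type) (A : qalg D K) (f : D -> K) (s eps : R) : R :=
  \sum_(x : outcomes A | eps < `|s - outcome_val x|) outcome_prob f x.

Definition nqueries (D K : Type) (A : qalg D K) : nat :=
  (\sum_(l : 'I_(qk A)) nn (qA A l))%N.

Local Open Scope ereal_scope.

Definition err_f (D K : Type) (S : (D -> K) -> R) (A : qalg D K) (f : D -> K)
  : \bar R :=
  ereal_inf [set eps%:E | eps in [set eps : R | (prob_err A f (S f) eps <= 4^-1)%R]].

Definition err_F (D K : Type) (S : (D -> K) -> R) (A : qalg D K) (F : set (D -> K))
  : \bar R :=
  ereal_sup [set err_f S A f | f in F].

Definition min_qerr (D K : Type) (n : nat) (S : (D -> K) -> R) (F : set (D -> K))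
  : \bar R :=
  ereal_inf [set err_F S A F | A in [set A : qalg D K | (nqueries A <= n)%N]].

Local Close Scope ereal_scope.

Definition LpN_norm (N : nat) (p : R) (f : 'I_N -> R) : R :=
  (N%:R^-1 * \sum_(i < N) `|f i| `^ p) `^ p^-1.

Definition BpN (N : nat) (p : R) : set ('I_N -> R) :=
  [set f | LpN_norm p f <= 1].

Definition SN (N : nat) (f : 'I_N -> R) : R := N%:R^-1 * \sum_(i < N) f i.

End QuantumModel.

(* Main.v *)
Require Import Defs.
From HB Require Import structures.
From mathcomp Require Import all_boot all_order all_algebra.
From mathcomp Require Import complex.
From mathcomp Require Import all_classical all_reals.
From mathcomp Require Import ereal exp.
From mathcomp Require Import ring lra zify.
Import Order.TTheory GRing.Theory Num.Theory.
Local Open Scope ring_scope.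

(* Let v = (N/(k+1))^(1/p) with k about 512 n^2/N. The multiples v 1_S of
   indicators with #|S| <= k+1 lie in the unit ball, and their means for
   #|S| = k and #|S| = k+1 differ by v/N, which is of order n^(-2/p) N^(2/p-1).
   An algorithm with smaller error therefore tells k-subsets from
   (k+1)-subsets, so the output distributions P_f, P_g for such a pair have
   Bhattacharyya overlap sum_x sqrt(P_f(x) P_g(x)) <= 7/8. On the other hand,
   by Ambainis' adversary argument, if f and g differ only at i, then one query
   lowers the overlap by at most lam m_f(i) + m_g(i)/lam, where m_f(i) is the
   squared amplitude with which f is queried at i. The overlap of real-valued
   square roots is multiplicative along the measurement history, so the
   argument passes through intermediate measurements. As m_f sums to at most 1
   over i, summing over all pairs (S, S + i) gives n >= c sqrt((N-k)(k+1)),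
   contrary to the choice of k. *)

(** * Real inner product of complex amplitude vectors *)

Section RealInnerProduct.
Context {R : realType}.
Local Notation C := (complex R).

(** The real part of the Hermitian product is enough for a lower bound on overlaps: unitaries
    preserve its sum [cdot], it is at most the product of the moduli, and all estimates stay in the
    ordered field [R]. *)
Definition dotc (z w : C) : R :=
  complex.Re z * complex.Re w + complex.Im z * complex.Im w.

Definition cdot {m : nat} (u v : 'cV[C]_m) : R := \sum_a dotc (u a 0) (v a 0).

Lemma sqnormE (z : C) : sqnorm z = dotc z z.
Proof. by rewrite /sqnorm /dotc !expr2. Qed.

Lemma sqnorm_ge0 (z : C) : 0 <= sqnorm z.
Proof. by rewrite addr_ge0 // sqr_ge0. Qed.

Lemma dotcE (z w : C) : dotc z w = complex.Re (Num.conj z * w).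
Proof. by case: z w => [a b] [c d]; rewrite /dotc /= mulNr opprK. Qed.

(** Completing the square: the difference of the two sides is [lam / 2] times the squared modulus of
    [x z + lam^-1 y w]. *)
Lemma dotc_ge (x y lam : R) (z w : C) : 0 < lam ->
  - (2^-1 * (lam * x ^+ 2 * sqnorm z + lam^-1 * y ^+ 2 * sqnorm w))
    <= x * y * dotc z w.
Proof.
case: z w => [a b] [c d] lam0; rewrite /sqnorm /dotc /= -subr_ge0.
have -> : x * y * (a * c + b * d) - - (2^-1 *
    (lam * x ^+ 2 * (a ^+ 2 + b ^+ 2) + lam^-1 * y ^+ 2 * (c ^+ 2 + d ^+ 2)))
  = 2^-1 * lam * ((x * a + lam^-1 * y * c) ^+ 2 + (x * b + lam^-1 * y * d) ^+ 2).
  by field; rewrite gt_eqF.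
by rewrite mulr_ge0 ?addr_ge0 ?sqr_ge0 // mulr_ge0 // ltW.
Qed.

(** Cauchy-Schwarz in the plane, from Lagrange's identity. *)
Lemma dotc_le_sqrt (z w : C) :
  dotc z w <= Num.sqrt (sqnorm z) * Num.sqrt (sqnorm w).
Proof.
rewrite -sqrtrM ?sqnorm_ge0 //; apply: le_trans (ler_norm _) _.
rewrite -sqrtr_sqr ler_wsqrtr //.
case: z w => [a b] [c d]; rewrite /sqnorm /dotc /= -subr_ge0.
suff -> : (a ^+ 2 + b ^+ 2) * (c ^+ 2 + d ^+ 2) - (a * c + b * d) ^+ 2
  = (a * d - b * c) ^+ 2 by exact: sqr_ge0.
ring.
Qed.

Lemma Re_sum (I : finType) (F : I -> C) :
  complex.Re (\sum_i F i) = \sum_i complex.Re (F i).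
Proof. by apply: (big_morph (@complex.Re R)) => // - [? ?] [? ?]. Qed.

Lemma cdotE m (u v : 'cV[C]_m) :
  cdot u v = complex.Re (((map_mx Num.conj u)^T *m v) 0 0).
Proof. by rewrite mxE Re_sum; apply: eq_bigr => a _; rewrite !mxE dotcE. Qed.

Lemma cdot_unitary {m} {U : 'M[C]_m} (u v : 'cV[C]_m) :
  unitary_mx U -> cdot (U *m u) (U *m v) = cdot u v.
Proof.
move=> [_ UU]; rewrite !cdotE map_mxM trmx_mul -mulmxA (mulmxA _ U).
by rewrite -/(adjmx U) UU mul1mx.
Qed.

Lemma cdot_delta m (b : 'I_m) : cdot (delta_mx b 0) (delta_mx b 0) = 1.
Proof.
rewrite /cdot (bigD1 b) //= big1 => [|a /negPf ab].
  by rewrite !mxE !eqxx /dotc /= mulr1 mulr0 !addr0.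
by rewrite !mxE ab /dotc /= !mulr0 addr0.
Qed.

End RealInnerProduct.

(** * The query as a permutation of basis states *)

Section Query.
Context {R : realType} {D : finType} {K : Type} (Q : query D K).
Local Notation C := (complex R).
Local Notation M := (2 ^ qm Q)%N.

Definition query_index (a : nat) : option {j : 'I_(2 ^ qm1 Q) | j \in qZ Q} :=
  [pick z : {j : 'I_(2 ^ qm1 Q) | j \in qZ Q} | val (val z) == (a %/ 2 ^ (qm Q - qm1 Q))%N].

(** A query on the basis state [a] evaluates the input at [i]. States whose index lies outside [qZ]
    hit no point, and queries fix them. *)
Definition hits (i : D) (a : nat) : bool :=
  if query_index a is Some z then qtau z == i else false.

(** There are [r] bits below the index register and [s] bits below the answer register, so a basis
    label reads [i 2^r + x 2^s + y]. *)
Let r := (qm Q - qm1 Q)%N.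
Let s := (r - qm2 Q)%N.

Let rE : (2 ^ r = 2 ^ qm2 Q * 2 ^ s)%N.
Proof. by rewrite -expnD subnKC // /r leq_subRL ?qm_le // (leq_trans _ (qm_le Q)) // leq_addr. Qed.

Let ME : (2 ^ qm Q = 2 ^ qm1 Q * 2 ^ r)%N.
Proof. by rewrite -expnD subnKC // (leq_trans _ (qm_le Q)) // leq_addr. Qed.

Let digits (a : nat) :
  a = (a %/ 2 ^ r * 2 ^ r + (a %/ 2 ^ s) %% 2 ^ qm2 Q * 2 ^ s + a %% 2 ^ s)%N.
Proof.
rewrite {1}(divn_eq a (2 ^ s)%N) {1}(divn_eq (a %/ 2 ^ s)%N (2 ^ qm2 Q)%N).
by rewrite -divnMA (mulnC (2 ^ s)%N) -rE mulnDl -mulnA -rE.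
Qed.

Lemma qmapE (f : D -> K) a : qmap Q f a =
  if query_index a is Some z then
    (a %/ 2 ^ r * 2 ^ r + ((a %/ 2 ^ s) %% 2 ^ qm2 Q + val (qbeta Q (f (qtau z)))) %% 2 ^ qm2 Q * 2 ^ s
      + a %% 2 ^ s)%N
  else a.
Proof. by []. Qed.

Let digits_divr i x y : (x < 2 ^ qm2 Q)%N -> (y < 2 ^ s)%N ->
  ((i * 2 ^ r + x * 2 ^ s + y) %/ 2 ^ r)%N = i.
Proof.
move=> xlt ylt; rewrite -addnA divnMDl ?expn_gt0 // divn_small ?addn0 //.
rewrite rE (@leq_trans (x * 2 ^ s + 2 ^ s)%N) ?ltn_add2l // -mulSnr leq_mul2r.
by rewrite xlt orbT.
Qed.

Let digits_mods i x y : (y < 2 ^ s)%N ->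
  ((i * 2 ^ r + x * 2 ^ s + y) %% 2 ^ s)%N = y.
Proof. by move=> ylt; rewrite rE mulnA -mulnDl modnMDl modn_small. Qed.

Let digits_divs i x y : (x < 2 ^ qm2 Q)%N -> (y < 2 ^ s)%N ->
  (((i * 2 ^ r + x * 2 ^ s + y) %/ 2 ^ s) %% 2 ^ qm2 Q)%N = x.
Proof.
move=> xlt ylt; rewrite rE mulnA -mulnDl divnMDl ?expn_gt0 //.
by rewrite (divn_small ylt) addn0 modnMDl modn_small.
Qed.

Lemma qmap_div f a : (qmap Q f a %/ 2 ^ r = a %/ 2 ^ r)%N.
Proof.
by rewrite qmapE; case: query_index => // z; rewrite digits_divr ?ltn_mod ?expn_gt0.
Qed.

Lemma query_index_qmap f a : query_index (qmap Q f a) = query_index a.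
Proof. by rewrite /query_index qmap_div. Qed.

Lemma hits_qmap f i a : hits i (qmap Q f a) = hits i a.
Proof. by rewrite /hits query_index_qmap. Qed.

Lemma qmap_agree f g i a : (forall j, j != i -> f j = g j) -> ~~ hits i a ->
  qmap Q f a = qmap Q g a.
Proof.
move=> fg; rewrite /hits !qmapE; by case: query_index => // z /fg ->.
Qed.

Lemma qmap_inj f : injective (qmap Q f).
Proof.
move=> a b ab; have := query_index_qmap f a; rewrite ab query_index_qmap => zba.
have := qmap_div f a; rewrite ab qmap_div => iE.
move: ab; rewrite !qmapE zba; case: query_index => // z ab.
have lt0 d : (0 < 2 ^ d)%N by rewrite expn_gt0.
have yE : (a %% 2 ^ s = b %% 2 ^ s)%N.
  by have := congr1 (modn^~ (2 ^ s)%N) ab; rewrite !digits_mods ?ltn_mod.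
have := congr1 (fun c => (c %/ 2 ^ s) %% 2 ^ qm2 Q)%N ab.
rewrite !digits_divs ?ltn_mod // => /eqP; rewrite eqn_modDr !modn_mod => /eqP xE.
by rewrite (digits a) (digits b) iE yE xE.
Qed.

Lemma ltn_qmap f {a} : (a < M)%N -> (qmap Q f a < M)%N.
Proof. by rewrite ME -!ltn_divLR ?expn_gt0 // qmap_div. Qed.

Definition qmap_ord f (a : 'I_M) : 'I_M := Ordinal (ltn_qmap f (ltn_ord a)).

Lemma qmap_ord_inj f : injective (qmap_ord f).
Proof. by move=> a b [/qmap_inj /val_inj]. Qed.

Lemma qmxE f (v : 'cV[C]_M) a : (qmx R Q f *m v) (qmap_ord f a) 0 = v a 0.
Proof.
rewrite mxE (bigD1 a) //= mxE eqxx mul1r big1 ?addr0 // => b ba.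
by rewrite mxE /= (inj_eq (@qmap_inj f)) val_eqE eq_sym (negPf ba) mul0r.
Qed.

Definition hit_mass (i : D) (v : 'cV[C]_M) : R := \sum_(a : 'I_M | hits i a) sqnorm (v a 0).

Lemma hit_mass_ge0 i v : 0 <= hit_mass i v.
Proof. by apply: sumr_ge0 => a _; exact: sqnorm_ge0. Qed.

Lemma hit_mass_qmx f i v : hit_mass i (qmx R Q f *m v) = hit_mass i v.
Proof.
rewrite /hit_mass (reindex_inj (qmap_ord_inj f)) /=.
by apply: eq_big => a; rewrite ?hits_qmap // => _; rewrite qmxE.
Qed.

(** Each basis state hits at most one point, so no amplitude is counted twice. *)
Lemma sum_hit_mass (v : 'cV[C]_M) : \sum_i hit_mass i v <= cdot v v.
Proof.
rewrite /hit_mass (exchange_big_dep predT) //=; apply: ler_sum => a _.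
rewrite -sqnormE /hits; case: query_index => [z|].
  by rewrite (eq_bigl (pred1 (qtau z))) ?big_pred1_eq // => i /=; rewrite eq_sym.
by rewrite big_pred0 ?sqnorm_ge0.
Qed.

Lemma cdot_qmx_same f (u v : 'cV[C]_M) : cdot (qmx R Q f *m u) (qmx R Q f *m v) = cdot u v.
Proof.
rewrite {1}/cdot (reindex_inj (qmap_ord_inj f)).
by apply: eq_bigr => a _; rewrite !qmxE.
Qed.

(* A query moves only the components whose query point is where f and g differ. *)
Lemma cdot_qmx f g i (u v : 'cV[C]_M) (x y lam : R) : 0 < lam ->
  (forall j, j != i -> f j = g j) ->
  x * y * cdot u v - (lam * x ^+ 2 * hit_mass i u + lam^-1 * y ^+ 2 * hit_mass i v)
    <= x * y * cdot (qmx R Q f *m u) (qmx R Q g *m v).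
Proof.
move=> lam0 fg; set w := qmx R Q g *m v.
rewrite {2}/cdot (reindex_inj (qmap_ord_inj f)) /=.
under [in leRHS]eq_bigr do rewrite qmxE.
have split2 (F : 'I_M -> R) :
    \sum_a F a = \sum_(a : 'I_M | hits i a) F a + \sum_(a : 'I_M | ~~ hits i a) F a.
  by rewrite (bigID (fun a : 'I_M => hits i a)).
rewrite /cdot !split2 [X in _ <= _ * (_ + X)](eq_bigr (fun a => dotc (u a 0) (v a 0))); last first.
  move=> a nh; congr dotc; have -> : qmap_ord f a = qmap_ord g a.
    by apply: val_inj => /=; exact: qmap_agree nh.
  exact: qmxE.
(* This bound is used twice, for the components of [w] and for those of [- v]. Both have squared
   mass [hit_mass i v], and each use costs half of the claimed loss. *)
have lb (z : 'I_M -> C) (S : R) : \sum_(a : 'I_M | hits i a) sqnorm (z a) = S ->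
  - (2^-1 * (lam * x ^+ 2 * hit_mass i u + lam^-1 * y ^+ 2 * S))
    <= x * y * \sum_(a : 'I_M | hits i a) dotc (u a 0) (z a).
  move=> <-; rewrite /hit_mass !mulr_sumr -big_split /= mulr_sumr -sumrN.
  by apply: ler_sum => a _; exact: dotc_ge.
have h1 : \sum_(a : 'I_M | hits i a) sqnorm (w (qmap_ord f a) 0) = hit_mass i v.
  rewrite -(hit_mass_qmx g) /hit_mass [RHS](reindex_inj (qmap_ord_inj f)) /=.
  by apply: eq_bigl => a; rewrite hits_qmap.
have h2 : \sum_(a : 'I_M | hits i a) sqnorm (- v a 0) = hit_mass i v.
  by apply: eq_bigr => a _; case: (v a 0) => ? ?; rewrite /sqnorm /= !sqrrN.
have h3 : \sum_(a : 'I_M | hits i a) dotc (u a 0) (- v a 0) = - \sum_(a : 'I_M | hits i a) dotc (u a 0) (v a 0).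
  by rewrite -sumrN; apply: eq_bigr => a _; rewrite /dotc; case: (v a 0) => ? ? /=; ring.
have := lb _ _ h1; have := lb _ _ h2; rewrite h3; lra.
Qed.

End Query.

(** * One run between measurements *)

Section OneStage.
Context {R : realType} {D : finType} {K : Type} (A : nalg R D K).
Local Notation C := (complex R).
Local Notation M := (2 ^ qm (nQ A))%N.

Definition state (f : D -> K) (b : 'I_M) (t : nat) : 'cV[C]_M :=
  iter_alg (fun j => @nU _ _ _ A (inord j)) (qmx R (nQ A) f) t *m delta_mx b 0.

Lemma stateS f b t : state f b t.+1 = @nU _ _ _ A (inord t.+1) *m (qmx R (nQ A) f *m state f b t).
Proof. by rewrite /state /= !mulmxA. Qed.

Lemma cdot_state f b t : cdot (state f b t) (state f b t) = 1.
Proof.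
elim: t => [|t IH]; first by rewrite (cdot_unitary _ _ (nU_unitary _)) cdot_delta.
by rewrite stateS (cdot_unitary _ _ (nU_unitary _)) cdot_qmx_same.
Qed.

Lemma nalg_mxE f y b : nalg_mx A f y b = state f b (nn A) y 0.
Proof. by rewrite /state -colE mxE. Qed.

Lemma sum_sqnorm_nalg f b : \sum_y sqnorm (nalg_mx A f y b) = 1.
Proof.
rewrite -(cdot_state f b (nn A)); apply: eq_bigr => y _.
by rewrite nalg_mxE sqnormE.
Qed.

Definition stage_mass (f : D -> K) (i : D) (b : 'I_M) : R :=
  \sum_(t < nn A) hit_mass (nQ A) i (state f b t).

Lemma stage_mass_ge0 f i b : 0 <= stage_mass f i b.
Proof. by apply: sumr_ge0 => t _; exact: hit_mass_ge0. Qed.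

Lemma sum_stage_mass f b : \sum_i stage_mass f i b <= (nn A)%:R.
Proof.
rewrite exchange_big /= -[n in n%:R]card_ord -sumr_const.
by apply: ler_sum => t _; rewrite -(cdot_state f b t) sum_hit_mass.
Qed.

(** Here [x] and [y] stand for the weights of the preceding history under [f] and [g]; carrying them
    along avoids normalising by a weight that may vanish. *)
Lemma stage_overlap f g i b (x y lam : R) :
  0 < lam -> 0 <= x -> 0 <= y -> (forall j, j != i -> f j = g j) ->
  x * y - (lam * (x ^+ 2 * stage_mass f i b) + lam^-1 * (y ^+ 2 * stage_mass g i b))
    <= x * y * \sum_z Num.sqrt (sqnorm (nalg_mx A f z b)) * Num.sqrt (sqnorm (nalg_mx A g z b)).
Proof.
move=> lam0 x0 y0 fg.
(* Unitaries preserve [cdot], so only queries cost: the query applied to the [j]-th states costs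
   their mass at [i]. *)
have step t : x * y - (lam * x ^+ 2 * (\sum_(j < t) hit_mass (nQ A) i (state f b j))
    + lam^-1 * y ^+ 2 * (\sum_(j < t) hit_mass (nQ A) i (state g b j)))
    <= x * y * cdot (state f b t) (state g b t).
  elim: t => [|t IH].
    by rewrite !big_ord0 !mulr0 addr0 subr0 (cdot_unitary _ _ (nU_unitary _)) cdot_delta mulr1.
  rewrite !stateS (cdot_unitary _ _ (nU_unitary _)) !big_ord_recr /=.
  have := cdot_qmx (nQ A) f g i (state f b t) (state g b t) x y lam lam0 fg.
  move: IH; move: (cdot _ _) (cdot _ _) => u v.
  move: (\sum_(j < t) _) (\sum_(j < t) _) (hit_mass _ _ _) (hit_mass _ _ _) => *.
  lra.
rewrite [lam * _]mulrA [lam^-1 * _]mulrA; apply: le_trans (step (nn A)) _.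
rewrite ler_wpM2l ?mulr_ge0 //; apply: ler_sum => z _.
by rewrite !nalg_mxE dotc_le_sqrt.
Qed.

End OneStage.

(** * Measurement histories and their overlap *)

Section Stages.
Context {R : realType} {D : finType} {K : Type} (A : qalg R D K).
Local Notation k := (qk A).
Local Notation outcome l := 'I_(2 ^ qm (nQ (@qA _ _ _ A l))).

Definition stage_input (x : outcomes A) (l : 'I_k) : outcome l :=
  @qb _ _ _ A l (Defs.prefix x l).

Definition update (x : outcomes A) (l : 'I_k) (y : outcome l) : outcomes A :=
  finfun (dfwith x l y).

(* Outcomes of the stages before [l] are encoded by the full outcome vectors
   that take a default value from stage [l] on. *)
Definition truncated (l : nat) (x : outcomes A) : bool :=
  [forall j : 'I_k, (l <= j)%N ==> (x j == @qb _ _ _ A j [::])].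

Lemma update_in x l y : update x l y l = y.
Proof. by rewrite ffunE dfwithin. Qed.

Lemma update_out x l y j : l != j -> update x l y j = x j.
Proof. by move=> lj; rewrite ffunE dfwithout. Qed.

Lemma prefix_update x (l : 'I_k) y l' : (l' <= l)%N -> Defs.prefix (update x l y) l' = Defs.prefix x l'.
Proof.
move=> ll; apply/eq_in_map => j; rewrite mem_filter => /andP[jl _].
rewrite update_out //; apply: contraTneq jl => <-.
by rewrite -leqNgt.
Qed.

Lemma truncatedP l (x : outcomes A) :
  reflect (forall j : 'I_k, (l <= j)%N -> x j = @qb _ _ _ A j [::]) (truncated l x).
Proof.
apply: (iffP forallP) => h j; last by apply/implyP => lj; rewrite h.
by move=> lj; apply/eqP; exact: (implyP (h j)).
Qed.

(** A history through stage [l] is a shorter history with one more outcome; resetting coordinate [l]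
    to its default recovers the shorter one. *)
Lemma sum_truncatedS (l : 'I_k) (F : outcomes A -> R) :
  \sum_(x | truncated l.+1 x) F x = \sum_(x | truncated l x) \sum_y F (update x l y).
Proof.
rewrite pair_big_dep /=.
rewrite (reindex_onto (fun p : outcomes A * outcome l => update p.1 l p.2)
          (fun x => (update x l (@qb _ _ _ A l [::]), x l))) /=; last first.
  move=> x _; apply/ffunP => j; case: (eqVneq l j) => [<-|lj].
    by rewrite update_in.
  by rewrite !update_out.
apply: eq_bigl => -[x y] /=; rewrite andbT update_in xpair_eqE eqxx andbT.
apply/andP/idP => [[/truncatedP t /eqP xE]|/truncatedP t].
  apply/truncatedP => j lj; rewrite -xE; case: (eqVneq l j) => [<-|nlj].
    by rewrite update_in.
  rewrite update_out // t // ltn_neqAle lj andbT.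
  by apply: contraNneq nlj => /val_inj ->.
split.
  apply/truncatedP => j lj; rewrite update_out ?t ?(ltnW lj) //.
  by apply: contraTneq lj => <-; rewrite ltnn.
apply/eqP/ffunP => j; case: (eqVneq l j) => [<-|lj].
  by rewrite update_in t.
by rewrite !update_out.
Qed.

Lemma truncated_all x : truncated k x.
Proof. by apply/truncatedP => j; rewrite leqNgt ltn_ord. Qed.

Lemma sum_truncated0 (F : outcomes A -> R) :
  \sum_(x | truncated 0 x) F x = F (finfun (fun j => @qb _ _ _ A j [::])).
Proof.
rewrite (big_pred1 (finfun (fun j => @qb _ _ _ A j [::]) : outcomes A)) // => x /=.
apply/truncatedP/eqP => [t|-> j _]; last by rewrite ffunE.
by apply/ffunP => j; rewrite ffunE t.
Qed.

Definition transition (f : D -> K) (l : 'I_k) (b y : outcome l) : R :=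
  Num.sqrt (sqnorm (nalg_mx (@qA _ _ _ A l) f y b)).

(** The square root of the probability of the first [l] outcomes of [x]. *)
Definition weight (f : D -> K) (l : nat) (x : outcomes A) : R :=
  \prod_(j : 'I_k | (j < l)%N) transition f j (stage_input x j) (x j).

Lemma weight_ge0 f l x : 0 <= weight f l x.
Proof. by apply: prodr_ge0 => j _; exact: sqrtr_ge0. Qed.

Lemma weight0 f x : weight f 0 x = 1.
Proof. by rewrite /weight big_pred0. Qed.

Lemma weightS f (l : 'I_k) x y :
  weight f l.+1 (update x l y) = weight f l x * transition f l (stage_input x l) y.
Proof.
rewrite /weight (bigD1 l) //= mulrC /stage_input update_in prefix_update //.
congr (_ * _); apply: eq_big => [j|j].
  by rewrite ltnS andbC -val_eqE -ltn_neqAle.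
rewrite ltnS andbC => /andP[jl jl'].
by rewrite update_out ?prefix_update // eq_sym.
Qed.

Lemma weight_sqr_prob f x : weight f k x ^+ 2 = outcome_prob f x.
Proof.
rewrite /weight -prodrXl /outcome_prob; apply: eq_big => [j|j _].
  by rewrite ltn_ord.
by rewrite sqr_sqrtr ?sqnorm_ge0.
Qed.

Lemma sum_weight_sqr f l : (l <= k)%N -> \sum_(x | truncated l x) weight f l x ^+ 2 = 1.
Proof.
elim: l => [|l IH] lk; first by rewrite sum_truncated0 weight0 expr1n.
rewrite -(IH (ltnW lk)) (sum_truncatedS (Ordinal lk)).
apply: eq_bigr => x _; rewrite -[RHS]mulr1.
rewrite -(sum_sqnorm_nalg (qA (Ordinal lk)) f (stage_input x (Ordinal lk))) mulr_sumr.
apply: eq_bigr => y _; rewrite (weightS f (Ordinal lk)) exprMn.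
by rewrite sqr_sqrtr ?sqnorm_ge0.
Qed.

Lemma sum_outcome_prob f : \sum_(x : outcomes A) outcome_prob f x = 1.
Proof.
rewrite -(sum_weight_sqr f k (leqnn _)).
by apply: eq_big => x; rewrite ?truncated_all // weight_sqr_prob.
Qed.

Lemma outcome_prob_ge0 f (x : outcomes A) : 0 <= outcome_prob f x.
Proof. by apply: prodr_ge0 => l _; exact: sqnorm_ge0. Qed.

(** The expectation, over the outcomes measured before stage [l], of the mass with which that stage
    queries [i]. *)
Definition query_mass_at (f : D -> K) (i : D) (l : 'I_k) : R :=
  \sum_(x | truncated l x)
     weight f l x ^+ 2 * stage_mass (@qA _ _ _ A l) f i (stage_input x l).

Definition query_mass (f : D -> K) (i : D) : R := \sum_l query_mass_at f i l.

Lemma query_mass_ge0 f i : 0 <= query_mass f i.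
Proof.
apply: sumr_ge0 => l _; apply: sumr_ge0 => x _.
by rewrite mulr_ge0 ?sqr_ge0 ?stage_mass_ge0.
Qed.

Lemma sum_query_mass f : \sum_i query_mass f i <= (nqueries A)%:R.
Proof.
rewrite exchange_big /= /nqueries natr_sum. apply: ler_sum => l _.
rewrite exchange_big /= -[leRHS]mul1r -[X in X * _](sum_weight_sqr f l (ltnW (ltn_ord l))).
rewrite mulr_suml; apply: ler_sum => x _.
rewrite -mulr_sumr; apply: ler_wpM2l; first exact: sqr_ge0.
exact: sum_stage_mass.
Qed.

Definition query_mass_before (f : D -> K) (i : D) (l : nat) : R :=
  \sum_(j : 'I_k | (j < l)%N) query_mass_at f i j.

Lemma query_mass_before0 f i : query_mass_before f i 0 = 0.
Proof. by rewrite /query_mass_before big_pred0. Qed.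

Lemma query_mass_beforeS f i (l : 'I_k) :
  query_mass_before f i l.+1 = query_mass_at f i l + query_mass_before f i l.
Proof.
rewrite /query_mass_before (bigD1 l) //=; congr (_ + _); apply: eq_bigl => j.
by rewrite ltnS andbC -val_eqE -ltn_neqAle.
Qed.

Lemma query_mass_before_all f i : query_mass_before f i k = query_mass f i.
Proof. by apply: eq_bigl => j; rewrite ltn_ord. Qed.

Definition overlap_before (f g : D -> K) (l : nat) : R :=
  \sum_(x | truncated l x) weight f l x * weight g l x.

Lemma overlap_before0 f g : overlap_before f g 0 = 1.
Proof. by rewrite /overlap_before sum_truncated0 !weight0 mulr1. Qed.

(** For each history, [stage_overlap] is applied with the two weights as factors; their squares are
    probabilities, so the losses add up to expected masses. *)
Lemma overlap_beforeS f g i lam (l : 'I_k) : 0 < lam ->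
  (forall j, j != i -> f j = g j) ->
  overlap_before f g l - (lam * query_mass_at f i l + lam^-1 * query_mass_at g i l)
    <= overlap_before f g l.+1.
Proof.
move=> lam0 fg; rewrite /overlap_before sum_truncatedS /query_mass_at.
rewrite !mulr_sumr -big_split -sumrN -big_split /=; apply: ler_sum => x _.
apply: le_trans (stage_overlap (qA l) f g i (stage_input x l) _ _ _
  lam0 (weight_ge0 f l x) (weight_ge0 g l x) fg) _.
rewrite mulr_sumr; apply: ler_sum => y _.
by rewrite !weightS mulrACA.
Qed.

Definition overlap (f g : D -> K) : R :=
  \sum_(x : outcomes A) weight f k x * weight g k x.

Lemma overlap_before_all f g : overlap_before f g k = overlap f g.
Proof. by apply: eq_bigl => x; exact: truncated_all. Qed.

Lemma overlap_ge f g i lam : 0 < lam -> (forall j, j != i -> f j = g j) ->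
  1 - (lam * query_mass f i + lam^-1 * query_mass g i) <= overlap f g.
Proof.
move=> lam0 fg.
rewrite -overlap_before_all -(query_mass_before_all f) -(query_mass_before_all g).
suff step l : (l <= k)%N ->
  1 - (lam * query_mass_before f i l + lam^-1 * query_mass_before g i l)
    <= overlap_before f g l by exact: step.
elim: l => [|l IH] lk.
  by rewrite overlap_before0 !query_mass_before0 !mulr0 addr0 subr0.
rewrite (query_mass_beforeS f i (Ordinal lk)) (query_mass_beforeS g i (Ordinal lk)).
have := overlap_beforeS f g i lam (Ordinal lk) lam0 fg.
move: (IH (ltnW lk)) => /=.
move: (overlap_before _ _ _) (overlap_before _ _ _) => u v.
move: (query_mass_before f _ _) (query_mass_before g _ _) => a b.
move: (query_mass_at f _ _) (query_mass_at g _ _) => c d; lra.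
Qed.

(* AM-GM with parameter 2 on the event where [f] errs and 1/2 on its complement,
   which is contained in the event where [g] errs. *)
Lemma overlap_le f g s s' eps :
  prob_err A f s eps <= 4^-1 -> prob_err A g s' eps <= 4^-1 ->
  eps + eps < `|s - s'| -> overlap f g <= 7 / 8.
Proof.
move=> ef eg ss.
pose E (x : outcomes A) := eps < `|s - outcome_val x|.
(* No output is within [eps] of both [s] and [s'], by the triangle inequality. *)
have sub x : ~~ E x -> eps < `|s' - outcome_val x|.
  rewrite /E -leNgt => h; rewrite ltNge; apply/negP => h'.
  have := ler_distD (outcome_val x) s s'; rewrite (distrC (outcome_val x) s'); lra.
have splitP h : \sum_(x | E x) outcome_prob h x + \sum_(x | ~~ E x) outcome_prob h x = 1.
  by rewrite -(sum_outcome_prob h) [RHS](bigID E).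
have gE : \sum_(x | ~~ E x) outcome_prob g x <= 4^-1.
  apply: le_trans eg; rewrite /prob_err [leRHS](bigID (fun x => ~~ E x)) /=.
  rewrite [X in _ <= X + _](eq_bigl (fun x => ~~ E x)); last first.
    by move=> x /=; case: (boolP (E x)) => [_|/sub ->]; rewrite ?andbF.
  by apply: ler_wpDr; rewrite ?sumr_ge0 // => x _; exact: outcome_prob_ge0.
have fE : \sum_(x | E x) outcome_prob f x <= 4^-1 := ef.
have amgm (P : pred (outcomes A)) u v :
  \sum_(x | P x) weight u k x * weight v k x
    <= \sum_(x | P x) outcome_prob u x + 4^-1 * \sum_(x | P x) outcome_prob v x.
  rewrite mulr_sumr -big_split /=; apply: ler_sum => x _.
  rewrite -!weight_sqr_prob -subr_ge0.
  have -> : weight u k x ^+ 2 + 4^-1 * weight v k x ^+ 2 - weight u k x * weight v k x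
    = (weight u k x - 2^-1 * weight v k x) ^+ 2 by field.
  exact: sqr_ge0.
(* With [a] the probability of [E] under [f] and [b] that of its complement under [g], the bound is
   [1/2 + 3 (a + b) / 4], and [a], [b] are at most [1/4]. *)
rewrite /overlap (bigID E) /=.
have h1 := amgm E f g.
have h2 := amgm (fun x => ~~ E x) g f.
have := splitP f; have := splitP g.
under [X in _ + X <= _]eq_bigr do rewrite mulrC.
lra.
Qed.

End Stages.

(** * Double counting over neighbouring subsets *)

Section Adversary.
Context {R : realType} {N : nat}.

(** Inserting [i] and removing [i] are inverse bijections between the two families of pairs. *)
Lemma sum_insert (T : finType) (k : nat) (G : {set T} -> T -> R) :
  \sum_(S : {set T} | #|S| == k) \sum_(i | i \notin S) G (i |: S)%SET i
  = \sum_(S : {set T} | #|S| == k.+1) \sum_(i in S) G S i.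
Proof.
rewrite !pair_big_dep /=.
rewrite [RHS](reindex_onto (fun p : {set T} * T => ((p.2 |: p.1)%SET, p.2))
                           (fun p => ((p.1 :\ p.2)%SET, p.2))) /=.
  apply: eq_bigl => -[S i] /=; rewrite cardsU1 setU11 andbT xpair_eqE eqxx andbT.
  case: (boolP (i \in S)) => iS /=; last by rewrite add1n eqSS setU1K // eqxx.
  rewrite andbF; apply/esym/negbTE/negP => /andP[_ /eqP SE].
  by move: iS; rewrite -SE !inE eqxx.
by move=> [S i] /= /andP[_ iS]; rewrite finset.setD1K.
Qed.

Definition scaled_indicator (v : R) (S : {set 'I_N}) : 'I_N -> R :=
  fun i => if i \in S then v else 0.

Lemma SN_scaled_indicator v S : SN (scaled_indicator v S) = N%:R^-1 * (v *+ #|S|).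
Proof. by rewrite /SN /scaled_indicator -big_mkcond sumr_const. Qed.

Lemma LpN_norm_scaled_indicator p v S : p != 0 ->
  LpN_norm p (scaled_indicator v S) = (N%:R^-1 * (`|v| `^ p *+ #|S|)) `^ p^-1.
Proof.
move=> p0; rewrite /LpN_norm; congr ((_ * _) `^ _).
rewrite -sumr_const [RHS]big_mkcond; apply: eq_bigr => i _.
by rewrite /scaled_indicator; case: ifP => // _; rewrite normr0 powR0.
Qed.

(* Ambainis' adversary bound for the relation between the [k]-subsets [S] and
   the [k.+1]-subsets [i |: S]: every [S] has [N - k] partners, every
   [k.+1]-subset has [k.+1] partners, and each pair differs in one input. *)
Lemma adversary_bound (A : qalg R 'I_N R) (F : {set 'I_N} -> 'I_N -> R) k (lam : R) :
  0 < lam ->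
  (forall (S : {set 'I_N}) i j, j != i -> F (i |: S)%SET j = F S j) ->
  (forall (S : {set 'I_N}) i, #|S| = k -> i \notin S -> overlap A (F S) (F (i |: S)%SET) <= 7 / 8) ->
  exists x y : R, [/\ 0 <= x, (k <= N)%N -> 0 < x, 0 <= y, y * k.+1%:R = x * (N - k)%:R &
    x * (N - k)%:R / 8 <= (nqueries A)%:R * (lam * x + lam^-1 * y)].
Proof.
move=> lam0 Fi Fo.
pose x : R := \sum_(S : {set 'I_N} | #|S| == k) 1.
pose y : R := \sum_(S : {set 'I_N} | #|S| == k.+1) 1.
have pairs : \sum_(S : {set 'I_N} | #|S| == k) \sum_(i | i \notin S) (1 : R) = x * (N - k)%:R.
  rewrite mulr_suml; apply: eq_bigr => S /eqP Sk.
  rewrite mul1r sumr_const; congr (_ *+ _).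
  have cC : (k + #|[predC S]| = N)%N by rewrite -Sk cardC card_ord.
  exact: etrans (esym (addKn k _)) (congr1 (subn^~ k) cC).
exists x, y; split.
- by apply: sumr_ge0.
- by move=> kN; rewrite /x sumr_const ltr0n -cardsE card_draws card_ord bin_gt0.
- by apply: sumr_ge0.
- rewrite -pairs (sum_insert _ k (fun _ _ => 1)) mulr_suml; apply: eq_bigr => S /eqP Sk.
  by rewrite mul1r sumr_const Sk.
rewrite -pairs mulr_suml.
(* The overlap of each pair falls from 1 to at most [7/8], so each pair accounts for a loss of at
   least [1/8]. *)
apply: (@le_trans _ _ (\sum_(S : {set 'I_N} | #|S| == k) \sum_(i | i \notin S)
   (lam * query_mass A (F S) i + lam^-1 * query_mass A (F (i |: S)%SET) i))).
  apply: ler_sum => S /eqP Sk; rewrite mulr_suml; apply: ler_sum => i iS.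
  have := overlap_ge A (F S) (F (i |: S)%SET) i lam lam0 (fun j ji => esym (Fi S i j ji)).
  have := Fo S i Sk iS; move: (overlap _ _ _) => o.
  move: (lam * _ + _) => m; lra.
have lin (a b : {set 'I_N} -> 'I_N -> R) :
    \sum_(S : {set 'I_N} | #|S| == k) \sum_(i | i \notin S) (lam * a S i + lam^-1 * b S i)
    = lam * (\sum_(S : {set 'I_N} | #|S| == k) \sum_(i | i \notin S) a S i)
      + lam^-1 * (\sum_(S : {set 'I_N} | #|S| == k) \sum_(i | i \notin S) b S i).
  rewrite !mulr_sumr -big_split; apply: eq_bigr => S _.
  by rewrite !mulr_sumr -big_split.
rewrite (lin (fun S => query_mass A (F S)) (fun S i => query_mass A (F (i |: S)%SET) i)).
rewrite [X in lam^-1 * X](sum_insert _ k (fun S => query_mass A (F S))).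
have mass_le (S : {set 'I_N}) (P : pred 'I_N) :
    \sum_(i | P i) query_mass A (F S) i <= (nqueries A)%:R.
  apply: le_trans (sum_query_mass A (F S)); rewrite [leRHS](bigID P) /=.
  by rewrite lerDl sumr_ge0 // => i _; exact: query_mass_ge0.
have total_le j (P : {set 'I_N} -> pred 'I_N) :
    \sum_(S : {set 'I_N} | #|S| == j) \sum_(i | P S i) query_mass A (F S) i
    <= (nqueries A)%:R * \sum_(S : {set 'I_N} | #|S| == j) 1.
  by rewrite mulr_sumr; apply: ler_sum => S _; rewrite mulr1.
rewrite mulrDr [_ * (lam * x)]mulrCA [_ * (lam^-1 * y)]mulrCA.
have lamV0 : 0 <= lam^-1 by rewrite invr_ge0 ltW.
apply: lerD; apply: ler_wpM2l.
- exact: ltW.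
- exact: (total_le k (fun S i => i \notin S)).
- exact: lamV0.
- exact: (total_le k.+1 (fun S i => i \in S)).
Qed.

End Adversary.

(** * From the minimal error to the adversary bound, and the choice of constants *)

Lemma err_F_lt_prob_err (R : realType) (D : finType) (K : Type) (S : (D -> K) -> R)
    (A : qalg R D K) (F : set (D -> K)) (c : R) (f : D -> K) :
  (err_F S A F < c%:E)%E -> F f -> prob_err A f (S f) c <= 4^-1.
Proof.
move=> Fc Ff.
have : (err_f S A f < c%:E)%E.
  by apply: le_lt_trans Fc; apply: ereal_sup_ubound; exists f.
(* Some tolerance [eps < c] is admissible, and raising it to [c] can only lower the error
   probability. *)
move=> /ereal_inf_lt [_ [eps /= he <-]]; rewrite lte_fin => epsc.
apply: le_trans he; rewrite /prob_err.
rewrite [leRHS](bigID (fun x => c < `|S f - outcome_val x|)) /=.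
rewrite [X in _ <= X + _](eq_bigl (fun x => c < `|S f - outcome_val x|)); last first.
  by move=> x /=; case: (ltP c _) => [/(lt_trans epsc) ->|_]; rewrite ?andbF.
by apply: ler_wpDr; rewrite ?sumr_ge0 // => x _; exact: outcome_prob_ge0.
Qed.

Lemma min_qerr_SN_ge (R : realType) (p : R) (n N k : nat) (c : R) :
  0 < p -> (0 < n)%N -> (0 < N)%N -> (2 * k <= N)%N ->
  512 * n%:R ^+ 2 < k.+1%:R * (N%:R : R) ->
  c + c < (N%:R / k.+1%:R) `^ p^-1 / N%:R ->
  (c%:E <= min_qerr n (@SN R N) (@BpN R N p))%E.
Proof.
move=> p0 n0 N0 kN nk cv; apply/ereal_infP => _ [A /= An <-].
rewrite leNgt; apply/negP => Ac.
set v := (N%:R / k.+1%:R) `^ p^-1 in cv.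
have N0' : 0 < (N%:R : R) by rewrite ltr0n.
have n0' : 0 < (n%:R : R) by rewrite ltr0n.
have k0' : 0 < (k.+1%:R : R) by rewrite ltr0n.
have v0 : 0 <= v by exact: powR_ge0.
have inB (S : {set 'I_N}) : (#|S| <= k.+1)%N -> @BpN R N p (scaled_indicator v S).
  move=> Sk; rewrite /BpN /= LpN_norm_scaled_indicator ?gt_eqF // ger0_norm //.
  rewrite /v -powRrM mulVf ?gt_eqF // powRr1 ?divr_ge0 //.
  have le1 : N%:R^-1 * (N%:R / k.+1%:R *+ #|S|) <= 1 :> R.
    rewrite -[X in _ * X]mulr_natr !mulrA mulVf ?gt_eqF // mul1r mulrC.
    by rewrite ler_pdivrMr // mul1r ler_nat.
   apply: (@le_trans _ _ (1 `^ p^-1)); last by rewrite powR1.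
  have pV : 0 <= p^-1 by rewrite invr_ge0 ltW.
  apply: (ge0_ler_powR pV _ _ le1); rewrite ?nnegrE //.
(* Balances the two costs: [n lam = N / 32] and [n / lam < (k + 1) / 16]. As [2 k <= N] and
   [(k + 1) y = (N - k) x], the first is at most and the second strictly below [(N - k) x / 16],
   while the adversary bound demands [(N - k) x / 8] in total. *)
pose lam : R := N%:R / (32 * n%:R).
have lam0 : 0 < lam by rewrite divr_gt0 ?mulr_gt0.
have [||x [y [x0 x0' y0 yx]]] := @adversary_bound R N A (scaled_indicator v) k lam lam0.
- move=> S i j ji; rewrite /scaled_indicator !inE (negPf ji); done.
- move=> S i Sk iS; have iSk : #|(i |: S)%SET| = k.+1 by rewrite cardsU1 iS Sk.
  apply: (overlap_le _ _ _ (SN (scaled_indicator v S)) (SN (scaled_indicator v (i |: S)%SET)) c).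
  + by apply: (err_F_lt_prob_err _ _ _ _ _ _ _ _ Ac); apply: inB; rewrite Sk.
  + by apply: (err_F_lt_prob_err _ _ _ _ _ _ _ _ Ac); apply: inB; rewrite iSk.
  rewrite !SN_scaled_indicator Sk iSk distrC -mulrBr mulrSr addrAC subrr add0r.
  by rewrite mulrC ger0_norm ?divr_ge0 // ltW.
have kN' : (k <= N)%N by apply: leq_trans kN; rewrite leq_pmull.
have {x0'} x0' := x0' kN'; have {x0} _ := x0.
rewrite natrB // in yx *.
have {}kN : 2 * (k%:R : R) <= N%:R by rewrite -natrM ler_nat.
have {}An : (nqueries A)%:R <= (n%:R : R) by rewrite ler_nat.
have lamV : n%:R * lam^-1 < k.+1%:R / 16 :> R.
  have -> : n%:R * lam^-1 = 32 * n%:R ^+ 2 / N%:R by rewrite /lam; field; rewrite !gt_eqF.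
  by rewrite ltr_pdivrMr //; lra.
have lamE : n%:R * lam = N%:R / 32 by rewrite /lam; field; rewrite gt_eqF.
(* Positivity of [y] keeps the second estimate strict. *)
have y0' : 0 < y.
  rewrite lt_neqAle y0 andbT; apply/eqP => yE; move: yx; rewrite -yE mul0r => /esym/eqP.
  by rewrite mulf_eq0 gt_eqF //= gt_eqF //; lra.
apply/negP; rewrite -ltNge.
apply: (@le_lt_trans _ _ (n%:R * (lam * x + lam^-1 * y))).
  by apply: ler_wpM2r An; apply: addr_ge0; apply: mulr_ge0; rewrite ?invr_ge0 ltW.
rewrite mulrDr [_ * (lam * x)]mulrA [_ * (lam^-1 * y)]mulrA lamE.
have h1 : n%:R * lam^-1 * y < k.+1%:R / 16 * y by rewrite ltr_pM2r.
have h2 : x * (2 * k%:R) <= x * N%:R by rewrite ler_wpM2l // ltW.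
lra.
Qed.

Theorem theorem4 (R : realType) (p : R) :
  1 <= p < 2 ->
  exists c0 c1 c2 : R,
    0 < c0 /\ 0 < c1 /\ 0 < c2 /\
    forall n N : nat, (0 < n)%N -> (0 < N)%N ->
      c0 * Num.sqrt (N%:R) <= n%:R <= c1 * N%:R ->
      ((c2 * n%:R `^ (- (2 / p)) * N%:R `^ (2 / p - 1))%:E
        <= min_qerr n (@SN R N) (@BpN R N p))%E.
Proof.
(* [c0 = 1] gives [N <= n^2], hence [(k + 1) N <= 513 n^2]; [c1 = 1/32] gives
   [k N <= (32 n)^2 / 2 <= N^2 / 2]; and [2 c2 = 1/1000] lies below [1/513]. *)
move=> /andP[p1 _]; exists 1, 32^-1, 2000^-1.
split; first exact: ltr01.
split; first by rewrite invr_gt0 ltr0n.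
split; first by rewrite invr_gt0 ltr0n.
move=> n N n0 N0 /andP[sqrtN_le n_le].
have p0 : 0 < p by lra.
have N0' : 0 < (N%:R : R) by rewrite ltr0n.
have n0' : 0 < (n%:R : R) by rewrite ltr0n.
have Nn : (N%:R : R) <= n%:R ^+ 2.
  rewrite -(sqr_sqrtr (ltW N0')) ler_pXn2r ?nnegrE ?sqrtr_ge0 ?ler0n //.
  by rewrite mul1r in sqrtN_le.
have n32 : (32 * n <= N)%N by rewrite -(ler_nat R) natrM; lra.
pose k := ((512 * n ^ 2) %/ N)%N.
have kN : (k * N <= 512 * n ^ 2)%N by exact: leq_divM.
have kN' : (512 * n ^ 2 < k.+1 * N)%N by exact: ltn_ceil.
have k2 : (2 * k <= N)%N.
  rewrite -(leq_pmul2r N0) -mulnA; apply: (@leq_trans (32 * n * (32 * n))); last exact: leq_mul.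
  by move: kN; rewrite expnS expn1; lia.
apply: (@min_qerr_SN_ge R p n N k) => //.
  by rewrite -natrX -!natrM ltr_nat.
have k0 : 0 < (k.+1%:R : R) by rewrite ltr0n.
have kle : k.+1%:R * N%:R <= 513 * n%:R ^+ 2 :> R.
  have : (k%:R * N%:R <= 512 * n%:R ^+ 2 :> R) by rewrite -natrX -!natrM ler_nat.
  by rewrite -natr1 mulrDl mul1r; lra.
have base : 513^-1 * (N%:R / n%:R) ^+ 2 <= N%:R / k.+1%:R :> R.
  rewrite ler_pdivlMr // expr_div_n.
  have -> : 513^-1 * (N%:R ^+ 2 / n%:R ^+ 2) * k.+1%:R
    = N%:R * ((k.+1%:R * N%:R) / (513 * n%:R ^+ 2)) :> R by field; rewrite gt_eqF.
  have d0 : 0 < 513 * n%:R ^+ 2 :> R by apply: mulr_gt0; rewrite ?ltr0n ?exprn_gt0.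
  rewrite -[leRHS]mulr1; apply: ler_wpM2l; first exact: ltW.
  rewrite ler_pdivrMr; last exact: d0.
  by rewrite mul1r; exact: kle.
have pV : 0 <= p^-1 by rewrite invr_ge0 ltW.
have low : 513^-1 * (n%:R `^ (- (2 / p)) * N%:R `^ (2 / p)) <= (N%:R / k.+1%:R) `^ p^-1 :> R.
  apply: (@le_trans _ _ ((513^-1 * (N%:R / n%:R) ^+ 2) `^ p^-1)); last first.
    by apply: (ge0_ler_powR pV _ _ base); rewrite nnegrE ?mulr_ge0 ?invr_ge0 ?exprn_ge0 ?divr_ge0 ?ler0n.
  rewrite powRM ?exprn_ge0 ?divr_ge0 ?invr_ge0 ?ler0n //.
  have -> : ((N%:R / n%:R) ^+ 2) `^ p^-1 = n%:R `^ (- (2 / p)) * N%:R `^ (2 / p) :> R.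
    rewrite -powR_mulrn ?divr_ge0 ?ltW // -powRrM powRM ?invr_ge0 ?ltW //.
    by rewrite mulrC -(powR_inv1 (ltW n0')) -powRrM mulN1r.
  rewrite ler_wpM2r ?mulr_ge0 ?powR_ge0 //.
  (* As [p >= 1], the power [513^(-1/p)] is at least [1/513], which makes [c2] independent of
     [p]. *)
  rewrite -(@powR_inv1 R 513) ?ler0n // -powRrM ler_powR ?ler1n //.
  by rewrite mulN1r lerN2 invf_le1.
have -> : N%:R `^ (2 / p - 1) = N%:R `^ (2 / p) / N%:R :> R.
  by rewrite powRB ?powRr1 ?ler0n // (gt_eqF N0') implybT.
set a := n%:R `^ _ in low *; set b := N%:R `^ _ in low *.
have ab : 0 < a * b by rewrite mulr_gt0 ?powR_gt0.
rewrite !mulrA -mulrDl ltr_pM2r ?invr_gt0 //.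
apply: lt_le_trans low; rewrite -!mulrA; lra.
Qed.
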